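(* Let $(X,d)$ be a metric vector space, let $C$ be a nonempty closed and convex subset of $X$, and let $f\colon C\to C$ be a single-valued mapping. Suppose that $f$ satisfies the following conditions: (a) $f\colon C\to C$ is onto; (b) for any finite subset $\{x_1,x_2,\ldots,x_n\}\subseteq C$ and for any convex combination $u=\sum_{i=1}^n\alpha_i x_i$, in which $\alpha_1,\ldots,\alpha_n$ are positive with $\sum_{i=1}^n\alpha_i=1$, we have $$\max\{d(f(x_j),u)-d(f(x_j),x_j) : j=1,2,\ldots,n\}\ge 0;$$ (c) there is $x^*\in C$ such that the subset $\{y\in C : d(f(x^* ),x^* )\le d(f(x^* ),y)\}$ of $C$ is compact. Then $f$ has a fixed point, i.e., there is $x_0\in C$ with $f(x_0)=x_0$.
   Context: A metric vector space $(X,d)$ is a (real) vector space $X$ equipped with a metric $d$ such that $X$ with the topology induced by $d$ is a topological vector space (addition and scalar multiplication are continuous). No continuity of $f$ is assumed. *)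

(* Defs.v *)
From mathcomp Require Import all_boot all_order all_algebra.
From mathcomp Require Import all_classical all_reals all_analysis.
Set Implicit Arguments.
Unset Strict Implicit.
Unset Printing Implicit Defensive.

Import Order.TTheory GRing.Theory Num.Theory.

Local Open Scope classical_set_scope.
Local Open Scope ring_scope.

Record is_metric (R : realType) (T : Type) (d : T -> T -> R) : Prop := {
  metric_ge0 : forall x y, 0 <= d x y ;
  metric_eq0 : forall x y, d x y = 0 <-> x = y ;
  metric_symm : forall x y, d x y = d y x ;
  metric_le_add : forall x y z, d x z <= d x y + d y z }.

(* Here [X] is already a topological vector space (addition and scaling are
   jointly continuous), so what remains is that [d] is a metric and that the
   topology of [X] is the one generated by the open [d]-balls. Neither
   translation invariance of [d] nor local convexity is required.
   A joint structure extending both [metricType] and [topologicalLmodType]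
   cannot be declared on top of the library: Hierarchy Builder requires such
   a join to be declared before [PseudoMetricNormedZmod]. *)
Record is_metric_vector_space (R : realType) (X : topologicalLmodType R)
    (d : X -> X -> R) : Prop := {
  mvs_metric : is_metric d ;
  mvs_nbhs : nbhs_ball_ (fun (x : X) (e : R) => [set y | d x y < e]) = nbhs }.

(* Maximum of a nonempty finite family. The seed of the iterated maximum is a
   member of the family, so that it does not alter the value. *)
Definition fmax (R : realType) (n : nat) (F : 'I_n.+1 -> R) : R :=
  \big[Num.max/F ord0]_(j < n.+1) F j.

(* Main.v *)
Require Import Defs.
From mathcomp Require Import all_boot all_order all_algebra.
From mathcomp Require Import all_classical all_reals all_analysis.
From mathcomp Require Import zify lra.
Set Implicit Arguments.
Unset Strict Implicit.
Unset Printing Implicit Defensive.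

Import Order.TTheory GRing.Theory Num.Theory.

(** For x in C put G(x) = {y in C | d(f(x), x) <= d(f(x), y)}. It suffices to
find a point y common to all the G(x): since f is onto, y = f(x0) for some x0,
and y in G(x0) says d(f(x0), x0) <= d(f(x0), f(x0)) = 0. The sets G(x) are
closed and one of them is compact, so a common point exists as soon as finitely
many G(x_i) always meet. Hypothesis (b) says that every convex combination of
the x_i, with positive weights, lies in one of the G(x_i): the G(x_i) form a KKM
family, and finitely many closed sets of a KKM family meet ([kkm]).

KKM is reduced to a covering statement about the standard simplex
([sperner_cover]): closed sets P_i that cover the simplex, each containing the
face t_i = 0, have a common point. If g_i >= 0 is a continuous function that
vanishes exactly on the i-th KKM set, then P_i = {t | t_i * sum_j g_j(t) <=
g_i(t)} is such a cover, because the weights t_i sum to 1. At a common point t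
of the P_i the KKM property gives i with t_i > 0 and g_i(t) = 0; hence
sum_j g_j(t) <= 0, and all g_j vanish at t.

The covering statement follows by compactness from a combinatorial fact about
the grid points of the simplex with denominator N: however they are coloured,
there is a small region in which every i either occurs as a colour or is a
coordinate that is nearly 0 ([scarf_grid]). No triangulation is needed, thanks
to Scarf's lemma ([scarf]): given a finite set with a total order for each i in
I, call S dominant when no point exceeds, in all the orders at once, the
respective minima of S; then some dominant set has all the colours. Its proof
is the parity argument of Sperner's lemma, with dominant sets as simplices: a
dominant set with #|I| - 1 elements is a face of exactly two dominant sets with
#|I| elements, unless it lies on the boundary ([card_extensions]). *)

(** * Scarf's lemma for a family of total orders *)

Section Scarf.
Import mathcomp.boot.fintype mathcomp.boot.finset.
(* Each total order on [T] is given by an injective rank function. *)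
Variables (I T : finType) (r : I -> T -> nat).
Hypothesis r_inj : forall i, injective (r i).

Definition dominant (S : {set T}) :=
  [forall t, exists i, forall y in S, r i t <= r i y].

Lemma dominantP (S : {set T}) :
  reflect (forall t, exists i, forall y, y \in S -> r i t <= r i y)
          (dominant S).
Proof.
apply: (iffP forallP) => domS t; have := domS t.
  by move=> /existsP[i /forall_inP]; exists i.
by move=> [i h]; apply/existsP; exists i; apply/forall_inP.
Qed.

Definition extensions (S : {set T}) :=
  [set x | (x \notin S) && dominant (x |: S)].

Lemma dominant_subset (A B : {set T}) : A \subset B -> dominant B -> dominant A.
Proof.
move=> /subsetP sAB /dominantP domB; apply/dominantP => t.
by have [i h] := domB t; exists i => y /sAB; apply: h.
Qed.

Section Pivot.
Variables (S : {set T}) (y1 : T).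
Hypotheses (y1S : y1 \in S) (domS : dominant S) (cardS : #|S|.+1 = #|I|).

(* In a dominant set every element is the minimum for some order. As [S] has
   one element less than there are orders, exactly two orders share their
   minimum. *)
Let m (i : I) : T := [arg min_(y < y1 in S) r i y].

Let mS i : m i \in S.
Proof. by rewrite /m; case: arg_minnP. Qed.

Let m_min i y : y \in S -> r i (m i) <= r i y.
Proof. by move=> yS; rewrite /m; case: arg_minnP => // z _; apply. Qed.

Let m_eq i y : y \in S -> r i y <= r i (m i) -> m i = y.
Proof.
by move=> yS le; apply: (@r_inj i); apply/eqP; rewrite eqn_leq m_min.
Qed.

Let m_surj y : y \in S -> exists i, m i = y.
Proof.
by move=> yS; have [i h] := dominantP _ domS y; exists i; apply: m_eq (h _ _).
Qed.

Let m_collision : exists i j, i != j /\ m i = m j.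
Proof.
have imS : m @: [set: I] = S.
  apply/setP => y; apply/imsetP/idP => [[i _ ->] //|/m_surj[i <-]].
  by exists i; rewrite ?inE.
have : ~~ [forall i, forall j, (m i == m j) ==> (i == j)].
  apply/negP => /forallP inj_m.
  have : injective m.
    by move=> i j /eqP eqm; have /forallP/(_ j)/implyP/(_ eqm)/eqP := inj_m i.
  by move=> m_inj; have := card_imset [set: I] m_inj; rewrite imS cardsT; lia.
rewrite negb_forall => /existsP[i]; rewrite negb_forall => /existsP[j].
by rewrite negb_imply => /andP[/eqP eqm ij]; exists i, j.
Qed.

Let m_inj i j : i != j -> m i = m j -> {in predC1 i &, injective m}.
Proof.
move=> ij eqm; apply/imset_injP; rewrite cardC1 -cardS /=.
suff -> : m @: predC1 i = S by [].
apply/setP => y; apply/imsetP/idP => [[k _ ->] //|/m_surj[k <-]].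
have [->|ki] := eqVneq k i; last by exists k.
by exists j; rewrite // inE eq_sym.
Qed.

(* If [x] extends [S], then [x] becomes the minimum for exactly one order,
   which must be one of the two that share their minimum, so that the shared
   minimum remains a minimum. For [x] to replace the minimum for the order
   [i], it must lie above all the other minima, and be the highest such point
   for the order [i], otherwise a higher one would refute dominance. *)
Let beyond i := [set t | [forall j, (j != i) ==> (r j (m j) < r j t)]].
Let beyond_max i :=
  [set x in beyond i | [forall t in beyond i, r i t <= r i x]].

Let beyondP i t :
  reflect (forall j, j != i -> r j (m j) < r j t) (t \in beyond i).
Proof.
rewrite inE; apply: (iffP forallP) => h j; first exact/implyP.
by apply/implyP; apply: h.
Qed.

Let beyond_maxP i x :
  reflect (x \in beyond i /\ forall t, t \in beyond i -> r i t <= r i x)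
          (x \in beyond_max i).
Proof.
rewrite /beyond_max in_set; apply: (iffP andP) => -[xi h]; split=> //;
  exact/forall_inP.
Qed.

Let card_beyond_max i t : t \in beyond i -> #|beyond_max i| = 1.
Proof.
move=> ti; pose x := [arg max_(x > t in beyond i) r i x].
have [xi xmax] : x \in beyond i /\ forall t, t \in beyond i -> r i t <= r i x.
  by rewrite /x; case: arg_maxnP.
apply/eqP/cards1P; exists x; apply/setP => z; rewrite [RHS]inE.
apply/beyond_maxP/eqP => [[zi zmax]|-> //].
by apply: (@r_inj i); apply/eqP; rewrite eqn_leq xmax ?zmax.
Qed.

Let beyond_max_extends i j x : i != j -> m i = m j -> x \in beyond_max i ->
  x \notin S /\ dominant (x |: S).
Proof.
move=> ij eqm /beyond_maxP[/beyondP xi xmax].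
have xS : x \notin S.
  apply/negP => /m_surj[k mk].
  have [ki|/xi] := eqVneq k i; last by rewrite mk; lia.
  by have := xi j; rewrite -eqm -ki mk eq_sym ki ij => /(_ isT); lia.
split=> //; apply/dominantP => t.
have [ti|] := boolP (t \in beyond i).
  exists i => y; rewrite !inE => /orP[/eqP ->|yS]; first exact: xmax.
  have [k domk] := dominantP _ domS t.
  have [<- //|ki] := eqVneq k i; first exact: domk.
  by have := beyondP _ _ ti _ ki; have := domk _ (mS k); lia.
rewrite inE negb_forall => /existsP[k].
rewrite negb_imply -leqNgt => /andP[ki le].
exists k => y; rewrite !inE => /orP[/eqP ->|yS].
  exact: leq_trans le (ltnW (xi _ ki)).
exact: leq_trans le (m_min _ yS).
Qed.

Let extends_beyond_max i j x : i != j -> m i = m j -> x \notin S ->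
    dominant (x |: S) -> (forall y, y \in x |: S -> r j (m i) <= r j y) ->
  x \in beyond_max i.
Proof.
move=> ij eqm xS domx jx.
have ltx k y : y \in S -> r k y <= r k x -> r k y < r k x.
  move=> yS; rewrite leq_eqVlt => /orP[/eqP/r_inj yx|//].
  by rewrite -yx yS in xS.
have xi : x \in beyond i.
  apply/beyondP => k ki; apply: ltx => //.
  have [l domk] := dominantP _ domx (m k).
  have mlk : m l = m k.
    by apply: m_eq => //; apply: domk; rewrite inE mS orbT.
  have lx : r l (m k) <= r l x by apply: domk; rewrite !inE eqxx.
  have [li|li] := eqVneq l i.
    have -> : k = j.
      by apply: (m_inj ij eqm); rewrite ?inE // ?[j == i]eq_sym -?eqm -?mlk ?li.
    by rewrite -eqm; apply: jx; rewrite !inE eqxx.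
  by rewrite -(m_inj ij eqm _ _ mlk) // mlk.
apply/beyond_maxP; split=> // t /beyondP ti.
have [k domk] := dominantP _ domx t.
have [<-|ki] := eqVneq k i; first by apply: domk; rewrite !inE eqxx.
have := ti _ ki; have : r k t <= r k (m k) by apply: domk; rewrite inE mS orbT.
lia.
Qed.

(** The two extensions come from the two orders [i], [j] that share their
minimum: one is the highest point above all minima but that of [i], the other
is obtained in the same way from [j]. They differ, since no point lies above all
the minima of a dominant set. The hypothesis says that [S] is not on the
boundary, where there is no point to choose for one of the orders. *)
Lemma card_extensions :
  (forall i, exists t, forall j, j != i ->
    exists2 y, y \in S & r j y < r j t) ->
  #|extensions S| = 2.
Proof.
move=> ext; have {}ext i : #|beyond_max i| = 1.
  have [t ht] := ext i; apply: (@card_beyond_max i t); apply/beyondP => j /ht.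
  by move=> [y yS]; apply: leq_ltn_trans (m_min _ _).
have [i [j [ij eqm]]] := m_collision.
have -> : extensions S = beyond_max i :|: beyond_max j.
  apply/setP => x; rewrite [LHS]inE [RHS]inE; apply/andP/orP.
    move=> [xS domx]; have [k domk] := dominantP _ domx (m i).
    have mk : m k = m i.
      by apply: m_eq => //; apply: domk; rewrite inE mS orbT.
    have [ki|ki] := eqVneq k i; [right|left].
      apply: (@extends_beyond_max j i); rewrite 1?eq_sym -?eqm //.
      by rewrite -ki => y ys; rewrite mk; apply: domk.
    apply: (@extends_beyond_max i j) => //.
    suff -> : j = k by [].
    by apply: (m_inj ij eqm); rewrite ?inE // 1?eq_sym -?eqm.
  move=> [|] h; first exact: beyond_max_extends ij eqm h.
  by apply: (@beyond_max_extends j i); rewrite // eq_sym.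
rewrite cardsU !ext; suff -> : beyond_max i :&: beyond_max j = set0.
  by rewrite cards0.
apply/setP => x; rewrite !in_set0; apply/negP.
rewrite inE => /andP[/beyond_maxP[/beyondP xi _] /beyond_maxP[/beyondP xj _]].
have [k domk] := dominantP _ domS x; have := domk _ (mS k).
have [ki|/xi] := eqVneq k i; last by lia.
by have := xj k; rewrite ki => /(_ ij); lia.
Qed.
End Pivot.

(* The slack [s i] acts as the vertex opposite to the face labelled [i]: it is
   lowest for the order [i] and above all ordinary points for the others, so
   that every ordinary point lies inside the simplex of the slacks. *)
Variables (s : I -> T) (c : T -> I) (i0 : I) (t0 : T).
Hypothesis s_min : forall i t, r i (s i) <= r i t.
Hypothesis s_top :
  forall i j t, j != i -> t \notin codom s -> r i t < r i (s j).
Hypothesis t0N : t0 \notin codom s.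
Hypothesis c_s : forall i, c (s i) = i.

Let s_inj : injective s.
Proof. exact: can_inj c_s. Qed.

(* The only door on the boundary. *)
Let S0 := s @: [set~ i0].

(* Its only extension is the highest ordinary point for the order [i0]. *)
Let S0_ext : #|extensions S0| = 1.
Proof.
pose x := [arg max_(x > t0 in [predC codom s]) r i0 x].
have [xN xmax] : x \notin codom s /\
    forall t, t \notin codom s -> r i0 t <= r i0 x.
  by rewrite /x; case: arg_maxnP.
apply/eqP/cards1P; exists x; apply/setP => z; rewrite !inE.
apply/andP/eqP => [[zS /dominantP domz]|->]; last first.
  split; first by apply: contra xN => /imsetP[i _ ->]; apply: codom_f.
  apply/dominantP => t; have [/codomP[i ->]|tN] := boolP (t \in codom s).
    by exists i.
  exists i0 => y; rewrite !inE => /orP[/eqP -> |/imsetP[j]]; first exact: xmax.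
  by rewrite !inE => ji ->; apply/ltnW/s_top.
have ltz t : t \notin codom s -> r i0 t <= r i0 z.
  move=> tN; have [i domi] := domz t.
  have [<-|ii0] := eqVneq i i0; first by apply: domi; rewrite !inE eqxx.
  have : r i t <= r i (s i).
    by apply: domi; rewrite !inE imset_f ?orbT // !inE.
  move=> le; case/codomP: tN; exists i; apply: (@r_inj i).
  by apply/eqP; rewrite eqn_leq le s_min.
have zN : z \notin codom s.
  apply/negP => /codomP[i zi]; have [ii0|ii0] := eqVneq i i0; last first.
    by rewrite zi imset_f ?inE in zS.
  have := ltz _ t0N; rewrite zi ii0 => le.
  case/codomP: t0N; exists i0; apply: (@r_inj i0).
  by apply/eqP; rewrite eqn_leq le s_min.
by apply: (@r_inj i0); apply/eqP; rewrite eqn_leq xmax ?ltz.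
Qed.

(* Doors see all the colours but [i0], each of them once. *)
Let is_door (S : {set T}) := (c @: S == [set~ i0]) && (#|S|.+1 == #|I|).

Let S0_door : is_door S0.
Proof.
rewrite /is_door card_imset // cardsC1.
have I_gt0 : 0 < #|I| by apply/card_gt0P; exists i0.
rewrite prednK // eqxx andbT -imset_comp; apply/eqP/setP => i.
apply/imsetP/idP => [[j ji -> /=]|ii0]; first by rewrite c_s.
by exists i; rewrite //= c_s.
Qed.

(* Otherwise there is an order [i] such that no point lies above all the minima
   but that of [i]. In particular [s i] does not, which forces [S] to consist
   of slacks; the colours of [S] then single out [S0]. *)
Let door_ext (S : {set T}) : is_door S -> dominant S -> S != S0 ->
  #|extensions S| = 2.
Proof.
move=> /andP[/eqP cS /eqP cardS] domS SN.
have [y1 y1S] : exists y1, y1 \in S.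
  apply/set0Pn; apply: contra SN => /eqP S_0; rewrite S_0 /S0.
  by move: cS; rewrite S_0 imset0 => <-; rewrite imset0.
apply: (card_extensions y1S) => // i.
suff /existsP[t /forallP h] :
    [exists t, forall j, (j != i) ==> [exists y in S, r j y < r j t]].
  exists t => j ji.
  by have /implyP/(_ ji)/exists_inP := h j.
apply: contraT => /existsPn/(_ (s i)).
rewrite negb_forall => /existsP[j]; rewrite negb_imply => /andP[ji hj].
have {}hj y : y \in S -> r j (s i) <= r j y.
  by rewrite leqNgt => yS; apply: contra hj => lt; apply/exists_inP; exists y.
have SS : S \subset s @: [set~ j].
  apply/subsetP => y yS; have le := hj _ yS.
  have /codomP[k yk] : y \in codom s.
    apply: contraT => yN.
    by move: (@s_top j i y); rewrite eq_sym ji yN => /(_ isT isT); lia.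
  rewrite yk imset_f // !inE; apply: contra ji => /eqP kj.
  rewrite yk kj in le; apply/eqP/s_inj/(@r_inj j)/eqP.
  by rewrite eqn_leq s_min le.
have {}SS : S = s @: [set~ j].
  apply/eqP; rewrite eqEcard SS card_imset // cardsC1; lia.
case/eqP: SN; rewrite SS /S0; suff -> : [set~ j] = [set~ i0] by [].
rewrite -cS SS -imset_comp; apply/setP => k.
apply/idP/imsetP => [kj|[l lj ->]]; first by exists k; rewrite //= c_s.
by rewrite /= c_s.
Qed.

(* If [Q] has a door [Q :\ x], then the colour of [x] is that of exactly one
   other element [x'], and [Q :\ x'] is the only other door of [Q]. *)
Let room_doors (Q : {set T}) : #|Q| = #|I| -> c @: Q != [set: I] ->
  ~~ odd #|[set x | (x \in Q) && is_door (Q :\ x)]|.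
Proof.
move=> cardQ cQ; set D := [set x | _].
have [->|/set0Pn[x]] := eqVneq D set0; first by rewrite cards0.
rewrite inE => /andP[xQ /andP[/eqP cQx /eqP cardQx]].
have inj : {in Q :\ x &, injective c}.
  by apply/imset_injP; rewrite cQx cardsC1 -cardQx.
have cx : c x != i0.
  apply: contra cQ => /eqP cx; rewrite -(setD1K xQ) imsetU1 cQx cx.
  by apply/eqP/setP => i; rewrite !inE orbN.
have /imsetP[x' x'Q cxx'] : c x \in c @: (Q :\ x) by rewrite cQx !inE.
have /andP[x'x x'Q'] : (x' != x) && (x' \in Q) by move: x'Q; rewrite !inE.
have -> : D = [set x; x'].
  apply/setP => z; rewrite !inE; apply/andP/orP.
    move=> [zQ /andP[/eqP cQz _]].
    have [->|zx] := eqVneq z x; [by left|right].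
    have zQx : z \in Q :\ x by rewrite !inE zx.
    have : c z \in c @: (Q :\ z) by rewrite cQz -cQx imset_f.
    move=> /imsetP[w]; rewrite !inE => /andP[wz wQ] czw.
    have [wx|wx] := eqVneq w x.
      by apply/eqP; apply: inj; rewrite // czw wx.
    by case/eqP: wz; apply: inj; rewrite // !inE wx.
  move=> [/eqP ->|/eqP ->]; first by rewrite xQ /is_door cQx cardQx !eqxx.
  split=> //; rewrite /is_door; apply/andP; split.
    rewrite -cQx; apply/eqP/setP => i; apply/imsetP/imsetP => -[w].
      rewrite !inE => /andP[wx' wQ] ->.
      by have [->|wx] := eqVneq w x; [exists x' | exists w; rewrite // !inE wx].
    rewrite !inE => /andP[wx wQ] ->.
    have [->|wx'] := eqVneq w x'; last by exists w; rewrite // !inE wx'.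
    by exists x; rewrite // !inE eq_sym x'x.
  by have := cardsD1 x' Q; rewrite x'Q' cardQ; lia.
by rewrite cards2 eq_sym x'x.
Qed.

(** The pairs (S, x) of a door [S] and an extension [x] are counted twice.
Door by door, their number is odd, because [S0] contributes 1 and any other
dominant door contributes 2. Room by room, i.e. for the dominant sets
[x |: S] with #|I| elements, it would be even if none had all the colours. *)
Lemma scarf : exists Q : {set T}, dominant Q /\ c @: Q = [set: I].
Proof.
suff /existsP[Q /andP[domQ /eqP cQ]] :
  [exists Q, dominant Q && (c @: Q == [set: I])] by exists Q.
apply: contraT => /existsPn noQ.
pose P (S : {set T}) x := [&& is_door S, x \notin S & dominant (x |: S)].
have count_doors : odd (\sum_(S : {set T}) #|[set x | P S x]|).
  have domS0 : dominant S0.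
    have : extensions S0 != set0.
      by rewrite -cards_eq0 S0_ext.
    case/set0Pn => x; rewrite inE => /andP[_].
    exact/dominant_subset/subsetUr.
  rewrite (bigD1 S0) //= oddD.
  have -> : [set x | P S0 x] = extensions S0.
    by apply/setP => x; rewrite !inE /P S0_door.
  rewrite S0_ext /=; elim/big_rec: _ => // S n SN IH; rewrite oddD negb_add.
  rewrite (negbTE IH).
  have [dS|dS] := boolP (is_door S); last first.
    suff -> : [set x | P S x] = set0 by rewrite cards0.
    by apply/setP => x; rewrite !inE /P (negbTE dS).
  have -> : [set x | P S x] = extensions S.
    by apply/setP => x; rewrite !inE /P dS.
  have [domS|domS] := boolP (dominant S); first by rewrite door_ext.
  suff -> : extensions S = set0 by rewrite cards0.
  apply/setP => x; rewrite !inE; apply/negP => /andP[_ domx].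
  by case/negP: domS; apply: dominant_subset domx; apply: subsetUr.
have count_rooms : ~~ odd (\sum_(Q : {set T} | dominant Q && (#|Q| == #|I|))
    #|[set x | (x \in Q) && is_door (Q :\ x)]|).
  elim/big_rec: _ => // Q n /andP[domQ /eqP cardQ] IH.
  rewrite oddD (negbTE IH) addbF; apply: room_doors => //.
  by have := noQ Q; rewrite domQ.
suff E : \sum_(S : {set T}) #|[set x | P S x]| =
    \sum_(Q : {set T} | dominant Q && (#|Q| == #|I|))
    #|[set x | (x \in Q) && is_door (Q :\ x)]|.
  by rewrite E (negbTE count_rooms) in count_doors.
have cardE (A : pred T) : #|[set x | A x]| = \sum_(x | A x) 1.
  by rewrite sum1dep_card.
under eq_bigr do rewrite cardE.
under [RHS]eq_bigr do rewrite cardE.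
rewrite (exchange_big_dep xpredT) //= [RHS](exchange_big_dep xpredT) //=.
apply: eq_bigr => x _.
(* For fixed [x], doors and rooms correspond by adding and removing [x]. *)
rewrite (reindex_onto (fun Q => Q :\ x) (fun S => x |: S)) /=; last first.
  by move=> S /and3P[_ xS _]; rewrite setU1K.
apply: eq_bigl => Q; rewrite /P.
have [xQ|xQ] := boolP (x \in Q); last first.
  rewrite andbF; apply/negP => /andP[_ /eqP QE].
  by rewrite -QE !inE eqxx in xQ.
rewrite setD1K // eqxx !inE eqxx /= andbT.
rewrite /is_door; have := cardsD1 x Q; rewrite xQ add1n => <-.
by case: (dominant Q); case: (_ == #|I|); case: (_ == _).
Qed.
End Scarf.

(** * Colourings of the grid points of a simplex *)

Section Grid.
Import mathcomp.boot.fintype mathcomp.boot.finset.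
(** Scarf's lemma is applied to the grid points, ordered by each coordinate, and
to the slacks. Let [Q] be a dominant set with all the colours, [C] the set of
the colours whose slack is not in [Q], and m_i the least i-th coordinate in
[Q] for i in [C]. If the sum of the m_i were less than N - n, a grid point could
exceed all the m_i, against dominance. So the grid points of [Q], whose
coordinates are at least m_i and sum to N, have their i-th coordinate in
[m_i, m_i + n], with m_i = 0 for i not in [C]. *)
Lemma scarf_grid n N (c : {ffun 'I_n.+1 -> 'I_N.+1} -> 'I_n.+1) :
  exists2 p : {ffun 'I_n.+1 -> 'I_N.+1}, \sum_i p i = N &
    forall i, exists q : {ffun 'I_n.+1 -> 'I_N.+1},
      [/\ \sum_j q j = N, forall j, p j <= q j + n /\ q j <= p j + n
        & c q = i \/ q i <= n].
Proof.
pose G : finType := {t : {ffun 'I_n.+1 -> 'I_N.+1} | \sum_i t i == N}.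
pose x (t : G) (i : 'I_n.+1) : nat := val t i.
have sum_x t : \sum_i x t i = N by apply/eqP; case: t.
have gridP (v : 'I_n.+1 -> nat) : \sum_i v i = N -> exists t : G, x t =1 v.
  move=> sum_v; have vN i : v i < N.+1.
    by rewrite ltnS -sum_v (bigD1 i) //= leq_addr.
  pose t : {ffun 'I_n.+1 -> 'I_N.+1} := [ffun i => Ordinal (vN i)].
  have t_grid : \sum_i t i == N.
    by rewrite -[X in _ == X]sum_v; apply/eqP/eq_bigr => i _; rewrite ffunE.
  by exists (Sub t t_grid) => i; rewrite /x SubK ffunE.
have [t0 _] : exists t : G, x t =1 (fun i => if i == ord0 then N else 0).
  by apply: gridP; rewrite -big_mkcond big_pred1_eq.
pose M := #|G|.
(* Ties between equal coordinates are broken by the enumeration of the grid. *)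
pose r (i : 'I_n.+1) (z : G + 'I_n.+1) := match z with
  | inl t => (x t i * M + enum_rank t).+1
  | inr j => if j == i then 0 else (N.+1 * M + j).+1
  end.
have ltM (t : G) : enum_rank t < M := ltn_ord _.
have xN t i : x t i <= N by rewrite -ltnS /x.
have r_lt i j t : j != i -> r i (inl t) < r i (inr j).
  move=> /negbTE ji; rewrite /r ji.
  by have := ltM t; have := leq_mul (xN t i) (leqnn M); nia.
have r_le i t u : r i (inl t) <= r i (inl u) -> x t i <= x u i.
  rewrite /r => le; rewrite leqNgt; apply/negP => lt.
  by have := leq_mul lt (leqnn M); have := ltM t; have := ltM u; nia.
have r_inj i : injective (r i).
  move=> [t|j] [u|k] //=; last 3 first.
  - have [->|ki] := eqVneq k i; first by [].
    have := r_lt _ _ t ki; rewrite /r (negbTE ki) => /[swap] ->.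
    by rewrite ltnn.
  - have [->|ji] := eqVneq j i; first by [].
    have := r_lt _ _ u ji; rewrite /r (negbTE ji) => /[swap] <-.
    by rewrite ltnn.
  - have [->|ji] := eqVneq j i; have [->|ki] := eqVneq k i => //.
    by move=> e; congr inr; apply: val_inj => /=; lia.
  move=> [] e; congr inl; apply/enum_rank_inj/val_inj => /=.
  rewrite -[LHS](modn_small (ltM t)) -[RHS](modn_small (ltM u)).
  by rewrite -(modnMDl (x t i)) e modnMDl.
have rank_slack i z : r i (inr i) <= r i z by rewrite /= eqxx.
have top_slack i j z :
    j != i -> z \notin codom (@inr G _) -> r i z < r i (inr j).
  by case: z => [t|k] ji; [move=> _; apply: r_lt | rewrite codom_f].
have t0N : inl t0 \notin codom (@inr G 'I_n.+1) by apply/codomP => -[].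
pose c' (z : G + 'I_n.+1) := match z with inl t => c (val t) | inr j => j end.
have [Q [/dominantP domQ cQ]] :=
  @scarf _ _ r r_inj inr c' ord0 (inl t0) rank_slack top_slack t0N
    (fun=> erefl).
pose C := [set i | inr i \notin Q].
have domC t : exists2 i, i \in C & forall y, inl y \in Q -> x t i <= x y i.
  have [i domi] := domQ (inl t); exists i; last by move=> y /domi/r_le.
  by rewrite inE; apply/negP => /domi; rewrite /r eqxx.
have colC i : i \in C -> exists2 q, inl q \in Q & c (val q) = i.
  rewrite inE => /negP iC.
  have /imsetP[[q|j] zQ i_eq] : i \in c' @: Q by rewrite cQ inE.
    by exists q.
  by case: iC; rewrite i_eq.
have [i1 i1C _] := domC t0; have [p pQ _] := colC _ i1C.
pose m i := if i \in C then x [arg min_(y < p | inl y \in Q) x y i] i else 0.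
have m_le i y : inl y \in Q -> m i <= x y i.
  by move=> yQ; rewrite /m; case: ifP => // _; case: arg_minnP => // z _; apply.
have m_eq i : i \in C -> exists2 y, inl y \in Q & m i = x y i.
  by move=> iC; rewrite /m iC; case: arg_minnP => // z zQ _; exists z.
have sum_m : N <= \sum_i m i + n.
  rewrite leqNgt; apply/negP => lt.
  (* The i-th coordinate must be at least m_i + 1 for i in [C]; the surplus is
     given to the colour [i1]. *)
  pose v i := m i + (i \in C) + (i == i1) * (N - (\sum_i m i + #|C|)).
  have sum_v : \sum_i v i = N.
    rewrite !big_split /= -big_distrl /=.
    have -> : \sum_i (i == i1 : nat) = 1.
      rewrite (bigD1 i1) //= eqxx big1 ?addn0 // => i /negbTE ->//.
    have -> : \sum_i (i \in C : nat) = #|C|.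
      rewrite -sum1_card [RHS]big_mkcond /=.
      by apply: eq_bigr => i _; case: (i \in C).
    have cardC : #|C| <= n.+1 by have := max_card (mem C); rewrite card_ord.
    rewrite mul1n subnKC //; apply: leq_trans (leq_add (leqnn _) cardC) _.
    by rewrite addnS.
  have [t tv] := gridP v sum_v; have [i iC le] := domC t.
  have [y yQ my] := m_eq i iC; have := le y yQ.
  by rewrite tv /v -my iC; lia.
have near_m i y : inl y \in Q -> x y i <= m i + n.
  move=> yQ; have := sum_x y; rewrite (bigD1 i) //=.
  have : \sum_(j | j != i) m j <= \sum_(j | j != i) x y j.
    by apply: leq_sum => j _; apply: m_le.
  by have := sum_m; rewrite (bigD1 i) //=; lia.
have close y z i : inl y \in Q -> inl z \in Q -> x y i <= x z i + n.
  by move=> yQ zQ; have := near_m i y yQ; have := m_le i z zQ; lia.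
exists (val p) => [|i]; first exact: sum_x.
have [iC|iC] := boolP (i \in C).
  have [q qQ cq] := colC i iC; exists (val q); split; [exact: sum_x| |by left].
  by move=> j; split; apply: close.
exists (val p); split; [exact: sum_x| |right].
  by move=> j; split; apply: leq_addr.
by have := near_m i p pQ; rewrite /m (negbTE iC).
Qed.
End Grid.

Import numFieldNormedType.Exports.

Local Open Scope classical_set_scope.
Local Open Scope ring_scope.

(** * Closed covers of the standard simplex *)

Definition simplex (R : realType) n : set 'rV[R]_n.+1 :=
  [set t | (forall i, 0 <= t ord0 i) /\ \sum_i t ord0 i = 1].

Lemma simplex_le1 (R : realType) n (t : 'rV[R]_n.+1) i :
  simplex t -> t ord0 i <= 1.
Proof.
move=> [t_ge0 <-]; rewrite (bigD1 i) //= lerDl; apply: sumr_ge0 => j _.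
exact: t_ge0.
Qed.

Lemma sum_fun_continuous (R : realType) (T : topologicalType) n
    (g : 'I_n -> T -> R) :
  (forall i, continuous (g i)) -> continuous (fun t => \sum_i g i t).
Proof.
by move=> g_cont; apply: (continuous_big (@add_continuous R)) => i _.
Qed.

Lemma simplex_compact (R : realType) n : compact (@simplex R n).
Proof.
apply: (@subclosed_compact _ _
  [set t : 'rV[R]_n.+1 | forall i, (`[0, 1]%classic : set R) (t ord0 i)]).
- have -> : @simplex R n = (\bigcap_(i in setT) [set t | 0 <= t ord0 i]) `&`
      [set t | \sum_i t ord0 i = 1].
    apply/seteqP; split=> t [t_ge0 sum_t]; split=> // i; [move=> _|];
      exact: t_ge0.
  apply: closedI.
    apply: closed_bigI => i _.
    apply: ((continuous_closedP (fun t : 'rV[R]_n.+1 => t ord0 i)).1 _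
      [set x | 0 <= x]).
      exact: coord_continuous.
    exact: closed_ge.
  apply: ((continuous_closedP (fun t : 'rV[R]_n.+1 => \sum_i t ord0 i)).1 _
    [set x | x = 1]).
    by apply: sum_fun_continuous => i; apply: coord_continuous.
  exact: closed_eq.
- apply: (@rV_compact R _ (fun=> `[0, 1]%classic)) => i.
  exact: segment_compact.
- move=> t st i; rewrite /= in_itv /= (simplex_le1 _ st) andbT.
  by case: st.
Qed.

(** Each grid point is coloured by the index of a set [P i] that contains it. *)
Lemma sperner_approx (R : realType) n (P : 'I_n.+1 -> set 'rV[R]_n.+1) (e : R) :
  0 < e -> (forall t, simplex t -> exists i, P i t) ->
  exists2 p, simplex p & forall i, exists q,
    [/\ simplex q, ball p e q & P i q \/ q ord0 i < e].
Proof.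
move=> e_gt0 P_cover.
(* Grid points whose coordinates differ by at most [n] are [n / N]-close. *)
pose N := (Num.truncn (n%:R / e)).+1.
have N_gt0 : 0 < N%:R :> R by rewrite ltr0n.
have n_small : n%:R / N%:R < e :> R.
  by rewrite ltr_pdivrMr // mulrC -ltr_pdivrMr // truncnS_gt.
pose pt (v : {ffun 'I_n.+1 -> 'I_N.+1}) : 'rV[R]_n.+1 :=
  \row_i ((v i)%:R / N%:R).
have pt_simplex (v : {ffun 'I_n.+1 -> 'I_N.+1}) :
    (\sum_i v i = N)%N -> simplex (pt v).
  move=> sum_v; split=> [i|]; first by rewrite mxE divr_ge0 ?ler0n.
  under eq_bigr do rewrite mxE.
  by rewrite -mulr_suml -natr_sum sum_v divff // gt_eqF.
have /choice[c cP] : forall t, exists i, simplex t -> P i t.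
  move=> t; have [/P_cover[i Pi]|nst] := pselect (simplex t); first by exists i.
  by exists ord0.
have [p sum_p near_p] := scarf_grid (fun v => c (pt v)).
exists (pt p); first exact: pt_simplex.
move=> i; have [q [sum_q pq cq]] := near_p i.
exists (pt q); split; first exact: pt_simplex.
  split=> // k j; rewrite ord1 !mxE /ball /= -mulrBl normrM normfV.
  rewrite (gtr0_norm N_gt0).
  apply: le_lt_trans n_small; rewrite ler_pM2r ?invr_gt0 //.
  have [] := pq j; rewrite -!(ler_nat R) !natrD => h1 h2.
  by rewrite ler_norml; lra.
case: cq => [cq|qn]; [left|right]; first by rewrite -cq; apply/cP/pt_simplex.
rewrite mxE; apply: le_lt_trans n_small.
by rewrite ler_pM2r ?invr_gt0 // ler_nat.
Qed.

(** The approximate solutions of [sperner_approx] form a filter as [e] tends to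
0, which has a cluster point [t] in the simplex. If [t] were not in [P i], then
[t ord0 i] would be positive, and a whole neighbourhood of [t] would avoid
[P i] as well as small i-th coordinates. *)
Lemma sperner_cover (R : realType) n (P : 'I_n.+1 -> set 'rV[R]_n.+1) :
  (forall i, closed (P i)) -> (forall t, simplex t -> exists i, P i t) ->
  (forall t i, simplex t -> t ord0 i = 0 -> P i t) ->
  exists2 t, simplex t & forall i, P i t.
Proof.
move=> P_closed P_cover P_face.
pose A e := [set p : 'rV[R]_n.+1 | simplex p /\ forall i, exists q,
    [/\ simplex q, ball p e q & P i q \/ q ord0 i < e]].
have A_filter : ProperFilter (filter_from [set e : R | 0 < e] A).
  apply: filter_from_proper; last first.
    by move=> e /= e0; have [p sp hp] := sperner_approx e0 P_cover; exists p.
  apply: filter_from_filter; first by exists 1 => /=.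
  move=> e e' /= e0 e'0; exists (Num.min e e') => /=.
    by rewrite lt_min e0.
  have A_mono a b : a <= b -> A a `<=` A b.
    move=> ab p [sp hp]; split=> // i; have [q [sq pq Pq]] := hp i.
    exists q; split=> //; first exact: le_ball pq.
    by case: Pq => [|lt]; [left|right; apply: lt_le_trans ab].
  by move=> p Ap; split; apply: A_mono Ap; rewrite ge_min lexx ?orbT.
have [|t [st t_cluster]] := @simplex_compact R n _ A_filter.
  by exists 1 => /=; [|move=> p []].
exists t => // i; apply: contrapT => nPt.
have t_gt0 : 0 < t ord0 i.
  rewrite lt_neqAle; case: (st) => -> _; rewrite andbT eq_sym.
  by apply/eqP => t0; apply: nPt; apply: P_face.
have : nbhs t (~` P i `&` [set q | t ord0 i / 2 < q ord0 i]).
  apply: filterI.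
    by apply: open_nbhs_nbhs; split=> //; apply: closed_openC.
  apply: (@coord_continuous R _ _ ord0 i t [set x | t ord0 i / 2 < x]).
  by apply: lt_nbhsr; lra.
move=> /nbhs_ballP[e /= e0 te].
pose e' := Num.min (e / 2) (t ord0 i / 2).
have e'0 : 0 < e' by rewrite lt_min; apply/andP; split; lra.
have A_e' : filter_from [set e : R | 0 < e] A (A e') by exists e'.
have [p [[sp /(_ i)[q [sq pq Pq]]] tp]] :=
  t_cluster _ _ A_e' (nbhsx_ballx t _ (divr_gt0 e0 (ltr0n _ 2))).
have : ball t e q.
  apply: ball_split tp _; apply: le_ball pq; by rewrite ge_min lexx.
move=> /te[nPq qi]; case: Pq => // qe; have : e' <= t ord0 i / 2.
  by rewrite ge_min lexx orbT.
by move: qi => /=; lra.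
Qed.

(** * The Knaster-Kuratowski-Mazurkiewicz theorem *)

(** The KKM theorem on the simplex, for the zero sets of the [g i]. *)
Lemma kkm_simplex (R : realType) n (g : 'I_n.+1 -> 'rV[R]_n.+1 -> R) :
  (forall i, continuous (g i)) -> (forall i t, 0 <= g i t) ->
  (forall t, simplex t -> exists2 i, 0 < t ord0 i & g i t = 0) ->
  exists2 t, simplex t & forall i, g i t = 0.
Proof.
move=> g_cont g_ge0 g_kkm.
pose G t := \sum_i g i t.
have [i|t st|t i st ti0|t st Pt] :=
  @sperner_cover R n (fun i => [set t : 'rV[R]_n.+1 | t ord0 i * G t <= g i t]).
- rewrite (_ : mkset _ =
      [set t : 'rV[R]_n.+1 | 0 <= g i t - t ord0 i * G t]); last first.
    by apply/seteqP; split=> t /=; rewrite subr_ge0.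
  apply: ((continuous_closedP
      (fun t : 'rV[R]_n.+1 => g i t - t ord0 i * G t)).1 _ [set x | 0 <= x]).
    move=> t; apply: (@cvgB _ R _ (nbhs t) _ (g i)
      (fun s : 'rV[R]_n.+1 => s ord0 i * G s)).
      exact: g_cont.
    apply: (@cvgM _ _ (nbhs t) _ (fun s : 'rV[R]_n.+1 => s ord0 i) G).
      exact: coord_continuous.
    exact: sum_fun_continuous.
  exact: closed_ge.
- apply: contrapT => noP; suff : G t < \sum_i t ord0 i * G t.
    by rewrite -mulr_suml; case: st => _ ->; rewrite mul1r ltxx.
  have lt i : g i t < t ord0 i * G t.
    by rewrite ltNge; apply/negP => le; apply: noP; exists i.
  rewrite /G [ltLHS]big_ord_recl [ltRHS]big_ord_recl.
  by apply: ltr_leD => //; apply: ler_sum => i _; apply: ltW.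
- by rewrite /= ti0 mul0r.
exists t => //; have [i ti gi] := g_kkm t st.
have := Pt i; rewrite /= gi pmulr_rle0 // => Gt j.
apply/eqP; rewrite eq_le g_ge0 andbT; apply: le_trans Gt.
by rewrite /G (bigD1 j) //= lerDl sumr_ge0.
Qed.

Lemma convex_set_sum (R : realType) (X : lmodType R) (C : set X) :
  convex_set C -> forall n (x : 'I_n.+1 -> X) (a : 'I_n.+1 -> R),
  (forall i, C (x i)) -> (forall i, 0 <= a i) -> \sum_i a i = 1 ->
  C (\sum_i a i *: x i).
Proof.
move=> C_convex; elim=> [|n IH] x a Cx a_ge0.
  by rewrite !big_ord1 => ->; rewrite scale1r.
rewrite big_ord_recr [in C _]big_ord_recr /=; set s := \sum_i _ => sum_a.
have s_ge0 : 0 <= s by apply: sumr_ge0.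
have s_le1 : s <= 1 by have := a_ge0 ord_max; move: sum_a; lra.
have aE : a ord_max = 1 - s by move: sum_a; lra.
have [s0|s_neq0] := eqVneq s 0.
  rewrite big1 ?aE ?s0 ?subr0 ?scale1r ?add0r // => i _.
  have := s0 => /eqP; rewrite psumr_eq0 // => /allP/(_ i).
  rewrite mem_index_enum.
  by move=> /(_ isT)/eqP ->; rewrite scale0r.
pose w := widen_ord (leqnSn n.+1).
pose y := \sum_i (a (w i) / s) *: x (w i).
have Cy : C y.
  apply: IH => // [i|]; first by rewrite divr_ge0.
  by rewrite -mulr_suml divff.
have : C (s *: y + (1 - s) *: x ord_max).
  apply: set_mem.
  exact: C_convex (Itv01 s_ge0 s_le1) (mem_set Cy) (mem_set (Cx _)).
rewrite -aE /y scaler_sumr; congr (C (_ + _)).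
by apply: eq_bigr => i _; rewrite scalerA mulrC divfK.
Qed.

Lemma convex_combination_continuous (R : realType) (X : topologicalLmodType R)
    n (x : 'I_n.+1 -> X) :
  continuous (fun t : 'rV[R]_n.+1 => \sum_i t ord0 i *: x i).
Proof.
apply: (continuous_big (@add_continuous X)) => i _ t.
apply: (@continuous2_cvg _ R^o X X (nbhs t) _ (fun s : 'rV[R]_n.+1 => s ord0 i)
  (fun=> x i) (fun (a : R^o) (v : X) => a *: v)).
- exact: (@scale_continuous R X (t ord0 i, x i)).
- exact: coord_continuous.
- exact: cvg_cst.
Qed.

(** The KKM sets are the sets [0 <= h i]; they are closed by continuity, and
the truncation [max 0 (- h i)] is the function that [kkm_simplex] wants. *)
Lemma kkm (R : realType) (X : topologicalLmodType R) n (x : 'I_n.+1 -> X)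
    (h : 'I_n.+1 -> X -> R) :
  (forall i, continuous (h i)) ->
  (forall t : 'rV[R]_n.+1, simplex t ->
    exists2 i, 0 < t ord0 i & 0 <= h i (\sum_j t ord0 j *: x j)) ->
  exists2 t : 'rV[R]_n.+1, simplex t &
    forall i, 0 <= h i (\sum_j t ord0 j *: x j).
Proof.
move=> h_cont h_kkm; pose phi (t : 'rV[R]_n.+1) := \sum_i t ord0 i *: x i.
pose g i t : R := Num.max 0 (- h i (phi t)).
have gE i t : (g i t = 0) <-> 0 <= h i (phi t).
  by rewrite /g; split=> [/max_idPl|le]; last apply/max_idPl; rewrite oppr_le0.
have [i t||t st|t st gt] := @kkm_simplex R n g.
- apply: (@continuous_max _ _ (fun=> 0) (fun s => - h i (phi s))).
    exact: cst_continuous.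
  apply: (@cvgN _ R _ (nbhs t) _ (fun s => h i (phi s))).
  apply: continuous_comp (h_cont i _).
  exact: convex_combination_continuous.
- by move=> i t; rewrite /g le_max lexx.
- by have [i ti hi] := h_kkm t st; exists i => //; apply/gE.
by exists t => // i; apply/gE.
Qed.

(** * The fixed point *)

Lemma metric_continuous (R : realType) (X : topologicalLmodType R)
    (d : X -> X -> R) : is_metric_vector_space d -> forall a, continuous (d a).
Proof.
move=> [[d_ge0 d_eq0 d_sym d_tri] d_nbhs] a y.
apply/cvgrPdist_lt => e e0.
suff : nbhs_ball_ (fun (x : X) (e : R) => [set z | d x z < e]) y
    [set z | `|d a y - d a z| < e] by rewrite d_nbhs.
exists e => //= z /= yz.
rewrite ltr_norml; have := d_tri a y z; have := d_tri a z y.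
by rewrite (d_sym z y); lra.
Qed.

Lemma fmax_ge0 (R : realType) n (F : 'I_n.+1 -> R) :
  0 <= fmax F -> exists i, 0 <= F i.
Proof.
move=> F_ge0; apply: contrapT => noF.
have F_lt0 i : F i < 0.
  by rewrite ltNge; apply/negP => Fi; apply: noF; exists i.
suff : fmax F < 0 by rewrite ltNge F_ge0.
by rewrite /fmax; elim/big_ind: _ => // u v u0 v0; rewrite gt_max u0.
Qed.

(** Dropping the zero weights of a convex combination does not change it; the
sums are stated for a general [F] because both the weights and the weighted
points must be summed. *)
Lemma simplex_support (R : realType) n (t : 'rV[R]_n.+1) : simplex t ->
  exists k (h : 'I_k.+1 -> 'I_n.+1), [/\ injective h,
    forall i, 0 < t ord0 (h i) &
    forall (V : nmodType) (F : 'I_n.+1 -> V),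
      (forall i, t ord0 i = 0 -> F i = 0) -> \sum_i F (h i) = \sum_i F i].
Proof.
move=> [t_ge0 sum_t]; pose J := [set i | 0 < t ord0 i]%SET.
have J0 i : i \notin J -> t ord0 i = 0.
  by rewrite inE -leNgt => ti; apply/eqP; rewrite eq_le ti t_ge0.
have sumJ (V : nmodType) (F : 'I_n.+1 -> V) :
    (forall i, t ord0 i = 0 -> F i = 0) -> \sum_(i in J) F i = \sum_i F i.
  move=> F0; rewrite [RHS](bigID (mem J)) /= [X in _ + X]big1 ?addr0 //.
  by move=> i /J0/F0.
have [k kJ] : exists k, #|J| = k.+1.
  exists #|J|.-1; rewrite prednK // card_gt0; apply/eqP => J_0.
  have := sumJ _ (fun i => t ord0 i) (fun _ => id).
  by rewrite sum_t J_0 big_set0 => /esym/eqP; rewrite oner_eq0.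
exists k, (fun i => enum_val (cast_ord (esym kJ) i)); split.
- exact: inj_comp enum_val_inj (@cast_ord_inj _ _ (esym kJ)).
- by move=> i; have := enum_valP (cast_ord (esym kJ) i); rewrite inE.
- move=> V F /sumJ <-; rewrite [RHS]big_enum_val.
  rewrite [RHS](reindex (cast_ord (esym kJ))) //=.
  exists (cast_ord kJ) => i _; first exact: cast_ordKV.
  exact: cast_ordK.
Qed.

Theorem theorem3 (R : realType) (X : topologicalLmodType R) (d : X -> X -> R)
    (X_metric : is_metric_vector_space d)
    (C : set X) (C_nonempty : C !=set0) (C_closed : closed C)
    (C_convex : convex_set C)
    (f : X -> X) (f_fun : set_fun C C f)
    (f_onto : set_surj C C f)
    (f_max : forall (n : nat) (x : 'I_n.+1 -> X) (alpha : 'I_n.+1 -> R),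
      injective x ->
      (forall i, C (x i)) ->
      (forall i, 0 < alpha i) ->
      \sum_(i < n.+1) alpha i = 1 ->
      let u : X := \sum_(i < n.+1) alpha i *: x i in
      0 <= fmax (fun j => d (f (x j)) u - d (f (x j)) (x j)))
    (f_compact : exists2 xs : X, C xs &
      compact [set y | C y /\ d (f xs) xs <= d (f xs) y]) :
  exists2 x0 : X, C x0 & f x0 = x0.
Proof.
have d_cont := metric_continuous X_metric.
pose G x := [set y | C y /\ d (f x) x <= d (f x) y].
have G_fin n (x : 'I_n.+1 -> X) : injective x -> (forall i, C (x i)) ->
    exists y, forall i, G (x i) y.
  move=> x_inj Cx.
  have [i y|t st|t st xt] :=
      @kkm R X n x (fun i y => d (f (x i)) y - d (f (x i)) (x i)).
  - apply: (@cvgB _ R _ (nbhs y) _ (d (f (x i))) (fun=> _)).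
      exact: d_cont.
    exact: cvg_cst.
  - have [k [h [h_inj th_gt0 sum_h]]] := simplex_support st.
    have sum_th : \sum_i t ord0 (h i) = 1.
      by rewrite (sum_h _ (fun i => t ord0 i)) //; case: st.
    have /fmax_ge0[j] := f_max k (x \o h) _ (inj_comp x_inj h_inj)
      (fun=> Cx _) th_gt0 sum_th.
    rewrite /= (sum_h _ (fun i => t ord0 i *: x i)); first by exists (h j).
    by move=> i ->; rewrite scale0r.
  exists (\sum_i t ord0 i *: x i) => i; split; last by rewrite -subr_ge0.
  by apply: convex_set_sum => //; case: st.
have [xs Cxs Gxs_compact] := f_compact.
have G_closed x : closed (G x).
  apply: closedI => //.
  apply: ((continuous_closedP (d (f x))).1 _ [set r | d (f x) x <= r]).
    exact: d_cont.
  exact: closed_ge.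
(* Intersecting with [G xs] turns the family into one of subsets of a compact
   set. *)
have G_finI : finI C (fun x => G xs `&` G x).
  move=> D DC.
  (* [xs] is added so that the family of points is not empty. *)
  have [s [s_uniq s_xs s_D sC]] : exists s : seq X,
      [/\ uniq s, xs \in s, (forall z, z \in finmap.enum_fset D -> z \in s)
        & forall z, z \in s -> C z].
    exists (undup (xs :: finmap.enum_fset D)); split; first exact: undup_uniq.
    - by rewrite mem_undup mem_head.
    - by move=> z zD; rewrite mem_undup inE; apply/orP; right.
    - move=> z; rewrite mem_undup inE => /orP[/eqP -> //|zD].
      exact: set_mem (DC z zD).
  have s_size : size s = (size s).-1.+1 by case: (s) s_xs.
  pose x (i : 'I_(size s).-1.+1) := nth xs s i.
  have lt_s (i : 'I_(size s).-1.+1) : (i < size s)%N.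
    by apply: leq_trans (ltn_ord i) _; rewrite -s_size.
  have x_inj : injective x.
    by move=> i j /eqP; rewrite nth_uniq // => /eqP/val_inj.
  have [i|y Gy] := @G_fin _ x x_inj; first exact/sC/mem_nth.
  have Gs z : z \in s -> G z y.
    move=> zs; have lt : (index z s < (size s).-1.+1)%N.
      by rewrite -s_size index_mem.
    by have := Gy (Ordinal lt); rewrite /x /= nth_index.
  by exists y => z /s_D zs; split; apply: Gs.
have [|y [Gxs_y y_cluster]] := Gxs_compact _ (finI_filter G_finI).
  exists (G xs `&` G xs); last by move=> ? [].
  exact: (finI_from1 (fun x => G xs `&` G x) Cxs).
have [x0 Cx0 fx0] := f_onto y Gxs_y.1.
exists x0 => //.
have [_ le] : G x0 y.
  apply: G_closed => U Uy; apply: (y_cluster (G x0) U) => //.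
  exists (G xs `&` G x0); last by move=> ? [].
  exact: (finI_from1 (fun x => G xs `&` G x) Cx0).
have [[d_ge0 d_eq0 _ _] _] := X_metric.
apply/d_eq0/eqP; rewrite eq_le d_ge0 andbT.
by apply: le_trans le _; rewrite -fx0 (d_eq0 _ _).2.
Qed.
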